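(* Let $N(\cdot)$ be a norm on $\mathbb{B}(\mathcal{H})$ and let $0\leq \nu\leq 1$. Then $w_{(N,\nu)}(\cdot)$ is a norm on $\mathbb{B}(\mathcal{H})$, and for every $A\in\mathbb{B}(\mathcal{H})$, $$\max\left\{\nu N(A), (1-\nu)N(A^* )\right\} \leq w_{(N,\nu)}(A) \leq \max\left\{N(A), N(A^* )\right\}.$$
   Context: $\mathcal{H}$ is a complex Hilbert space and $\mathbb{B}(\mathcal{H})$ is the algebra of all bounded linear operators on $\mathcal{H}$. For $0\leq\nu\leq1$ and $A\in\mathbb{B}(\mathcal{H})$, $\mathfrak{R}_{\nu}(A)=\nu A+(1-\nu)A^*$. For an arbitrary norm $N(\cdot)$ on the complex vector space $\mathbb{B}(\mathcal{H})$ (no further assumption), define $$w_{(N,\nu)}(A)=\sup_{\theta\in\mathbb{R}}N\left(\mathfrak{R}_{\nu}(e^{i\theta}A)\right)=\sup_{\theta\in\mathbb{R}}N\left(\nu e^{i\theta}A+(1-\nu)e^{-i\theta}A^*\right).$$ *)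

(* Defs.v *)
From HB Require Import structures.
From mathcomp Require Import all_boot all_order all_algebra.
From mathcomp Require Import all_classical all_reals all_analysis.
From mathcomp Require Import complex.

Set Implicit Arguments.
Unset Strict Implicit.
Unset Printing Implicit Defensive.

Import Order.TTheory GRing.Theory Num.Theory.
Import numFieldNormedType.Exports.

Local Open Scope classical_set_scope.
Local Open Scope ring_scope.
Local Open Scope complex_scope.

(* [inner] is linear in its first argument and conjugate-linear in its second.
   Completeness is that of the norm topology, inherited from
   [completeNormedModType]. *)
HB.mixin Record CompleteNormedModule_isHilbert (R : realType) (H : Type)
    & CompleteNormedModule R[i] H := {
  inner : {dot H for (@conjc R)} ;
  sqr_norm_inner : forall x : H, `|x| ^+ 2 = inner x x
}.

#[short(type="hilbertType")]
HB.structure Definition Hilbert (R : realType) :=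
  {H of CompleteNormedModule R[i] H & CompleteNormedModule_isHilbert R H}.

Section BoundedOperators.
Context {R : realType} (H : hilbertType R).

Definition bounded_linear : {pred H -> H} :=
  [pred f : H -> H |
    `[< linear f /\ exists M : R[i], forall x, `|f x| <= M * `|x| >]].

Lemma bounded_linearP (f : H -> H) :
  reflect (linear f /\ exists M : R[i], forall x, `|f x| <= M * `|x|)
          (f \in bounded_linear).
Proof. exact: asboolP. Qed.

Lemma bounded_linear_submod_closed : submod_closed bounded_linear.
Proof.
split=> [|a f g /bounded_linearP[lf [M fM]] /bounded_linearP[lg [M' gM]]];
  apply/bounded_linearP; split.
- by move=> a x y /=; rewrite scaler0 addr0.
- by exists 0 => x; rewrite normr0 mul0r.
- move=> b x y; rewrite !fctE lf lg !scalerDr !scalerA addrACA.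
  by rewrite [b * a]mulrC.
- exists (`|a| * M + M') => x; rewrite mulrDl -mulrA.
  rewrite (le_trans (ler_normD _ _))// lerD// !fctE.
  by rewrite normrZ ler_wpM2l.
Qed.

HB.instance Definition _ := GRing.isSubmodClosed.Build R[i] (H -> H)
  bounded_linear bounded_linear_submod_closed.

(* B(H), with the pointwise complex vector space structure. *)
Record bop := Bop { bop_fun :> H -> H ; _ : bop_fun \in bounded_linear }.

HB.instance Definition _ := [isSub for bop_fun].
HB.instance Definition _ := [Choice of bop by <:].
HB.instance Definition _ := [SubChoice_isSubLmodule of bop by <:].

End BoundedOperators.

Section NumericalRadius.
Context {R : realType} {H : hilbertType R}.

Definition is_adjoint (A B : bop H) : Prop :=
  forall x y : H, inner (A x) y = inner x (B y).

(* Such a B exists by the Riesz representation theorem (H is complete) and is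
   unique, so the default value 0 is never used for lack of an adjoint. *)
Definition adjoint (A : bop H) : bop H := xget 0 [set B | is_adjoint A B].

Definition expi (theta : R) : R[i] := cos theta +i* sin theta.

Definition Rnu (nu : R) (A : bop H) : bop H :=
  nu%:C *: A + (1 - nu)%:C *: adjoint A.

(* The supremum is taken in the extended reals, so that its finiteness is not
   presupposed. *)
Definition wnu (N : bop H -> R) (nu : R) (A : bop H) : \bar R :=
  ereal_sup [set (N (Rnu nu (expi theta *: A)))%:E | theta in [set: R]].

End NumericalRadius.

(* A norm on a complex vector space; [Normc.normc] is the real-valued modulus
   of a complex number. *)
Record is_norm {R : realType} {V : lmodType R[i]} (N : V -> R) : Prop := IsNorm {
  is_norm_ge0 : forall x, 0 <= N x ;
  is_norm_eq0 : forall x, N x = 0 -> x = 0 ;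
  is_normZ : forall (c : R[i]) x, N (c *: x) = Normc.normc c * N x ;
  is_normD : forall x y, N (x + y) <= N x + N y
}.

(* Main.v *)
Require Import Defs.
From mathcomp Require Import all_boot all_order all_algebra.
From mathcomp Require Import all_classical all_reals all_analysis.
From mathcomp Require Import complex.
From mathcomp Require Import ring lra.

(** Write [w A] for [wnu N nu A] and A' for the adjoint of A.

    The upper bound is the triangle inequality: [Rnu nu (e^(it) A)] is a
    convex combination of [e^(it) A] and [e^(-it) A'], whose [N]-norms are
    [N A] and [N A'] ([N_Rnu_le_max]).  Hence the supremum defining [w A] is
    finite.

    The lower bound comes from two angles only, t = 0 and t = pi/2:
    [Rnu nu A = nu A + (1 - nu) A'], while
    [Rnu nu (iA) = i (nu A - (1 - nu) A')] ([Rnu_i]), so that [nu A] and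
    [(1 - nu) A'] are the half sum and the half difference of two operators
    whose [N]-norm is at most [w A] ([nuN_le], [nuNadjoint_le]).  Since nu and
    1 - nu cannot both vanish and A'' = A, this also gives definiteness.

    Subadditivity of [w] is that of [N], because [Rnu nu] is additive.  For
    homogeneity, a complex scalar is a nonnegative real times a phase
    ([polar]); [Rnu nu] commutes with real scalars and the phase is absorbed by
    the supremum.  This gives [w (c A) <= |c| w A], and the converse is the
    same inequality for the inverse of c.

    All this uses that the adjoint is conjugate-linear and involutive, hence
    first that it exists.  That is the Riesz representation theorem, proved in
    [riesz_real] for the real inner product Re <x, y> by minimising
    [<x, x> - 2 f x] over the complete space H; [adjoint_exists] recovers the
    complex statement by replacing x with ix. *)

Import Order.TTheory GRing.Theory Num.Theory.
Import numFieldNormedType.Exports.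

Local Open Scope classical_set_scope.
Local Open Scope ring_scope.

(** * The underlying real inner product space *)

Section ReComplex.
Local Open Scope complex_scope.

Lemma ReD (R : realType) (a b : R[i]) :
  complex.Re (a + b) = complex.Re a + complex.Re b.
Proof. by case: a b => ? ? []. Qed.

Lemma ReMl (R : realType) (t : R) (a : R[i]) :
  complex.Re (t%:C * a) = t * complex.Re a.
Proof. by case: a => ? ? /=; rewrite mul0r subr0. Qed.

Lemma ReJ (R : realType) (a : R[i]) : complex.Re a^* = complex.Re a.
Proof. by case: a. Qed.

End ReComplex.

Section RealInnerProduct.
Local Open Scope complex_scope.
Context {R : realType} {H : hilbertType R}.
Implicit Types x y z : H.

Definition rinner x y : R := complex.Re (inner x y).
Definition rnorm x : R := complex.Re `|x|.

Lemma normE x : `|x| = (rnorm x)%:C.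
Proof. by rewrite /rnorm RRe_real// realE normr_ge0. Qed.

Lemma rnorm_ge0 x : 0 <= rnorm x.
Proof. by rewrite -ler0c -normE. Qed.

Lemma rnorm_sqr x : rnorm x ^+ 2 = rinner x x.
Proof. by rewrite /rinner -sqr_norm_inner normE -rmorphXn. Qed.

Lemma rinnerC x y : rinner x y = rinner y x.
Proof. by rewrite /rinner hermC expr0 mul1r ReJ. Qed.

Lemma rinnerDl x y z : rinner (x + y) z = rinner x z + rinner y z.
Proof. by rewrite /rinner linearDl ReD. Qed.

Lemma rinnerZl (t : R) x y : rinner (t%:C *: x) y = t * rinner x y.
Proof. by rewrite /rinner linearZl_LR ReMl. Qed.

Lemma rinnerDr x y z : rinner x (y + z) = rinner x y + rinner x z.
Proof. by rewrite rinnerC rinnerDl !(rinnerC x). Qed.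

Lemma rinnerZr (t : R) x y : rinner x (t%:C *: y) = t * rinner x y.
Proof. by rewrite rinnerC rinnerZl rinnerC. Qed.

Definition rinnerE := (rinnerDl, rinnerDr, rinnerZl, rinnerZr).

Lemma scaleN1C x : (-1)%:C *: x = - x.
Proof. by rewrite rmorphN rmorph1 scaleN1r. Qed.

Lemma rnorm_eq0 x : rnorm x = 0 -> x = 0.
Proof. by move=> x0; apply/normr0_eq0; rewrite normE x0. Qed.

Lemma rinner_cauchy_schwarz x y : `|rinner x y| <= rnorm x * rnorm y.
Proof.
have [y0|y0] := eqVneq (rnorm y) 0.
  rewrite (rnorm_eq0 _ y0) -(scale0r 0) rinnerZr mul0r normr0.
  by rewrite mulr_ge0// rnorm_ge0.
have Y0 : 0 < rinner y y.
  by rewrite -rnorm_sqr exprn_gt0// lt_neqAle eq_sym y0 rnorm_ge0.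
rewrite -ler_sqr ?nnegrE ?mulr_ge0 ?rnorm_ge0//.
rewrite exprMn !rnorm_sqr real_normK ?num_real//.
(* [t *: y] is the orthogonal projection of x on the real line R y. *)
set t := rinner x y / rinner y y.
have := sqr_ge0 (rnorm (x + (- t)%:C *: y)).
have -> : rnorm (x + (- t)%:C *: y) ^+ 2
  = (rinner x x * rinner y y - rinner x y ^+ 2) / rinner y y.
  by rewrite rnorm_sqr !rinnerE (rinnerC y x) /t; field; rewrite gt_eqF.
by rewrite pmulr_lge0 ?invr_gt0// subr_ge0.
Qed.

(** Completeness of H speaks of balls whose radius is a positive element of
    [R[i]]; such a radius is real, so sequences can be handled with real
    epsilons. *)
Lemma rnorm_complete (u : nat -> H) :
  (forall e : R, 0 < e -> exists K, forall m n, (K <= m)%N -> (K <= n)%N ->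
     rnorm (u m - u n) < e) ->
  exists z, forall e : R, 0 < e -> exists K, forall n, (K <= n)%N ->
     rnorm (u n - z) < e.
Proof.
move=> uC.
have : cvg (u @ \oo).
  apply: cauchy_cvg; apply: cauchy_exP => e e0.
  have eE : e = (complex.Re e)%:C by rewrite RRe_real// gtr0_real.
  rewrite eE ltcR in e0; have [K uK] := uC _ e0.
  exists (u K); rewrite /fmapE -ball_normE /ball_ eE; exists K => // n /= Kn.
  by rewrite normE ltcR uK.
move=> /cvg_ex[z uz]; exists z => e e0.
have e0' : 0 < e%:C by rewrite ltcR.
have [K _ uK] := (@cvgr_distC_lt _ _ _ _ _ _ _ uz _ e0').
by exists K => n Kn; have := uK n Kn; rewrite /= normE ltcR.
Qed.

Lemma le0_of_le_eps (a k : R) :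
  0 <= k -> (forall e, 0 < e -> a <= e * k) -> a <= 0.
Proof.
move=> k0 ak; rewrite leNgt; apply/negP => a0.
have k1 : 0 < k + 1 by lra.
have := ak (a / (k + 1)) (divr_gt0 a0 k1).
rewrite mulrAC ler_pdivlMr//; nra.
Qed.

(** Riesz representation theorem for real functionals.  If z minimises
    [J x = <x, x> - 2 f x], the first variation [2 (<x, z> - f x)] of [J] at z
    vanishes.  A minimiser exists because [J] is bounded below and, by the
    parallelogram identity, [|x - y|^2] is at most twice the sum of the
    excesses of [J x] and [J y] over the infimum, so minimising sequences are
    Cauchy. *)
Lemma riesz_real (f : H -> R) (M : R) :
  (forall x y, f (x + y) = f x + f y) ->
  (forall (t : R) x, f (t%:C *: x) = t * f x) ->
  (forall x, `|f x| <= M * rnorm x) ->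
  exists z, forall x, f x = rinner x z.
Proof.
move=> fD fZ fM.
have [J JE] : exists J, forall x, J x = rinner x x - 2 * f x.
  by exists (fun x => rinner x x - 2 * f x).
have JM x : - M ^+ 2 <= J x.
  have := fM x; have := sqr_ge0 (rnorm x - M); have := ler_norm (f x).
  by rewrite JE -rnorm_sqr; nra.
pose m := inf (range J).
have infJ : has_inf (range J).
  by split; [exists (J 0); exists 0 | exists (- M ^+ 2) => _ [x _ <-]].
have mJ x : m <= J x by apply: ge_inf; [case: infJ | exists x].
have /choice[u Ju] (n : nat) : exists x, J x < m + n.+1%:R^-1.
  have n0 : 0 < n.+1%:R^-1 :> R by rewrite invr_gt0.
  have [_ [x _ <-] xm] := inf_adherent n0 infJ.
  by exists x.
clearbody m.
have parallelogram x y :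
  rnorm (x - y) ^+ 2 = 2 * J x + 2 * J y - 4 * J (2^-1%:C *: (x + y)).
  by rewrite rnorm_sqr !JE -scaleN1C !rinnerE fZ fD (rinnerC y x); field.
have inv_small (e : R) :
    0 < e -> exists K, forall n, (K <= n)%N -> n.+1%:R^-1 < e.
  move=> e0; exists (Num.truncn e^-1) => n Kn.
  rewrite invf_plt ?posrE ?ltr0n//; apply: lt_le_trans (truncnS_gt _) _.
  by rewrite ler_nat.
have [|z uz] := rnorm_complete u.
  move=> e e0; have [|K eK] := inv_small (e ^+ 2 / 4).
    by rewrite divr_gt0// exprn_gt0.
  exists K => p q Kp Kq.
  rewrite -ltr_sqr ?nnegrE ?rnorm_ge0 ?ltW// parallelogram.
  have := mJ (2^-1%:C *: (u p + u q)); have := Ju p; have := Ju q.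
  have := eK p Kp; have := eK q Kq.
  move: p.+1%:R^-1 q.+1%:R^-1 => a b; lra.
exists z => d.
pose G := rinner d z - f d; pose D := rinner d d.
have D0 : 0 <= D by rewrite /D -rnorm_sqr sqr_ge0.
(* [J (z + t d) >= J z]: up to errors controlled by [e], this is
   [J (u n + t d) >= m > J (u n) - e], with [u n] close to z. *)
have quad t : - (2 * t * G + t ^+ 2 * D) <= 0.
  apply: (@le0_of_le_eps _ (1 + 2 * `|t| * rnorm d)).
    by rewrite addr_ge0// !mulr_ge0// rnorm_ge0.
  move=> e e0; have [K1 H1] := uz e e0; have [K2 H2] := inv_small e e0.
  have {H1} := H1 (maxn K1 K2) (leq_maxl _ _).
  have {H2} := H2 (maxn K1 K2) (leq_maxr _ _).
  move: (maxn K1 K2) => n ne uze.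
  have Jn : - e <= 2 * t * (rinner d (u n) - f d) + t ^+ 2 * D.
    have := mJ (u n + t%:C *: d); have := Ju n; rewrite !JE !rinnerE fD fZ.
    rewrite (rinnerC (u n) d) -/D; move: ne; move: n.+1%:R^-1 => a; lra.
  have GE : rinner d (u n) - f d = G + rinner d (u n - z).
    by rewrite /G -scaleN1C !rinnerE; ring.
  have tG : 2 * t * rinner d (u n - z) <= e * (2 * `|t| * rnorm d).
    apply: le_trans (ler_norm _) _.
    rewrite !normrM (ger0_norm (_ : 0 <= 2))//.
    have -> : e * (2 * `|t| * rnorm d) = 2 * `|t| * (rnorm d * e) by ring.
    rewrite ler_wpM2l ?mulr_ge0//.
    apply: le_trans (rinner_cauchy_schwarz _ _) _.
    by rewrite ler_wpM2l ?rnorm_ge0// ltW.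
  by rewrite GE in Jn; lra.
have D1 : 0 < D + 1 by lra.
have G0 : G ^+ 2 <= 0.
  (* The exact minimiser of [2 t G + t^2 D] is [- G / D]; the denominator
     [D + 1] still makes the value negative unless G = 0, and is never 0. *)
  have := quad (- G / (D + 1)).
  have -> : - (2 * (- G / (D + 1)) * G + (- G / (D + 1)) ^+ 2 * D) =
    G ^+ 2 * ((D + 2) / (D + 1) ^+ 2) by field; rewrite gt_eqF.
  by rewrite pmulr_lle0// divr_gt0 ?exprn_gt0//; lra.
by move: G0; rewrite expr2 => G0; have : G = 0; [nra | rewrite /G; lra].
Qed.

End RealInnerProduct.

(** * The adjoint *)

Section Adjoint.
Local Open Scope complex_scope.
Context {R : realType} {H : hilbertType R}.
Implicit Types (x y z : H) (A B : bop H).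

Lemma innerC x y : inner x y = (inner y x)^*.
Proof. by rewrite hermC expr0 mul1r. Qed.

Lemma innerDl x y z : inner (x + y) z = inner x z + inner y z.
Proof. exact: linearDl. Qed.

Lemma innerZl a x y : inner (a *: x) y = a * inner x y.
Proof. exact: linearZl_LR. Qed.

Lemma innerDr x y z : inner x (y + z) = inner x y + inner x z.
Proof. exact: linearDr. Qed.

Lemma innerZr a x y : inner x (a *: y) = a^* * inner x y.
Proof. exact: linearZr_LR. Qed.

Lemma inner_inj z z' : (forall x, inner x z = inner x z') -> z = z'.
Proof.
move=> zz'; apply/subr0_eq/rnorm_eq0/eqP; rewrite -sqrf_eq0 rnorm_sqr.
by rewrite -scaleN1C rinnerDr rinnerZr /rinner zz' mulN1r subrr.
Qed.

Lemma bop_linear A : linear A.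
Proof. by case: A => f /= /bounded_linearP[]. Qed.

Lemma bopD A x y : A (x + y) = A x + A y.
Proof. by have := bop_linear A 1 x y; rewrite !scale1r. Qed.

Lemma bop0 A : A 0 = 0.
Proof. by apply: (addrI (A 0)); rewrite -bopD !addr0. Qed.

Lemma bopZ A a x : A (a *: x) = a *: A x.
Proof. by have := bop_linear A a x 0; rewrite bop0 !addr0. Qed.

Lemma bop_bounded A :
  exists2 M : R, 0 <= M & forall x, rnorm (A x) <= M * rnorm x.
Proof.
case: A => f /= /bounded_linearP[lf [M fM]].
exists (Normc.normc M); first by rewrite -ler0c (_ : _%:C = `|M|).
move=> x; rewrite -lecR rmorphM /= -!normE (_ : _%:C = `|M|)//.
(* [M] is any complex number, but [M * |x| >= |f x| >= 0] is its own modulus. *)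
by rewrite -[`|x|]normr_id -normrM ger0_norm// (le_trans _ (fM x)).
Qed.

(** [riesz_real] represents the functional Re <Ax, y>; evaluated at ix, the
    representation also matches the imaginary parts.  The representing map is
    bounded since |By|^2 = <A(By), y> <= M |By| |y|. *)
Lemma adjoint_exists A : exists B, is_adjoint A B.
Proof.
have [M M0 AM] := bop_bounded A.
have /choice[B AB] y : exists z, forall x, rinner (A x) y = rinner x z.
  apply: (@riesz_real _ _ (fun x => rinner (A x) y) (M * rnorm y)).
  - by move=> x x'; rewrite bopD rinnerDl.
  - by move=> t x; rewrite bopZ rinnerZl.
  - move=> x; apply: le_trans (rinner_cauchy_schwarz _ _) _.
    by rewrite mulrAC ler_wpM2r ?rnorm_ge0.
have adjB x y : inner (A x) y = inner x (B y).
  have := AB y x; have := AB y ('i *: x); rewrite bopZ /rinner !innerZl.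
  case: (inner (A x) y) (inner x (B y)) => a b [c d] /=.
  by simpc => /oppr_inj-> ->.
suff Bb : B \in @bounded_linear R H by exists (Bop Bb).
apply/bounded_linearP; split.
  move=> a y y'; apply: inner_inj => x.
  by rewrite -adjB !innerDr !innerZr !adjB.
exists M%:C => y; rewrite !normE -rmorphM lecR.
have [->|By0] := eqVneq (rnorm (B y)) 0; first by rewrite mulr_ge0 ?rnorm_ge0.
have By : 0 < rnorm (B y) by rewrite lt_neqAle eq_sym By0 rnorm_ge0.
rewrite -(ler_pM2l By) -expr2 rnorm_sqr -AB.
apply: le_trans (ler_norm _) _; apply: le_trans (rinner_cauchy_schwarz _ _) _.
by rewrite mulrA [_ * M]mulrC ler_wpM2r ?rnorm_ge0.
Qed.

Lemma adjointP A : is_adjoint A (adjoint A).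
Proof.
rewrite /adjoint; case: xgetP => [B _ //|].
by have [B AB] := adjoint_exists A => /(_ B).
Qed.

Lemma adjoint_unique A B : is_adjoint A B -> adjoint A = B.
Proof.
move=> AB; apply/val_inj/funext => y; apply: inner_inj => x.
by rewrite -[RHS]AB -[LHS]adjointP.
Qed.

Lemma adjointK A : adjoint (adjoint A) = A.
Proof.
apply: adjoint_unique => x y.
by rewrite innerC -adjointP -innerC.
Qed.

Lemma adjointD A B : adjoint (A + B) = adjoint A + adjoint B.
Proof.
by apply: adjoint_unique => x y; rewrite innerDl innerDr !adjointP.
Qed.

Lemma adjointZ (a : R[i]) A : adjoint (a *: A) = a^* *: adjoint A.
Proof.
apply: adjoint_unique => x y; rewrite innerZl innerZr adjointP.
by congr (_ * _); exact: (esym (conjcK a)).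
Qed.

Lemma adjoint0 : adjoint (0 : bop H) = 0.
Proof. by apply: (addrI (adjoint 0)); rewrite -adjointD !addr0. Qed.

Lemma adjointZr (r : R) A : adjoint (r%:C *: A) = r%:C *: adjoint A.
Proof. by rewrite adjointZ; congr (_ *: _); exact: conjc_real. Qed.

Lemma adjointZi A : adjoint ('i *: A) = - ('i *: adjoint A).
Proof. by rewrite adjointZ -scaleNr; congr (_ *: _); rewrite /=; simpc. Qed.

End Adjoint.

(** * The operators [Rnu nu A] and complex phases *)

Section Rnu.
Local Open Scope complex_scope.
Context {R : realType} {H : hilbertType R} (nu : R).
Implicit Types A B : bop H.

Lemma RnuD A B : Rnu nu (A + B) = Rnu nu A + Rnu nu B.
Proof. by rewrite /Rnu adjointD !scalerDr addrACA. Qed.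

Lemma RnuZ (r : R) A : Rnu nu (r%:C *: A) = r%:C *: Rnu nu A.
Proof. by rewrite /Rnu adjointZr scalerDr !scalerA ![_ * r%:C]mulrC. Qed.

Lemma Rnu_i A :
  Rnu nu ('i *: A) = 'i *: (nu%:C *: A - (1 - nu)%:C *: adjoint A).
Proof.
by rewrite /Rnu adjointZi scalerBr scalerN !scalerA ![_ * 'i]mulrC.
Qed.

End Rnu.

Section Phases.
Local Open Scope complex_scope.

Lemma polar (R : realType) (c : R[i]) :
  exists theta, c = (Normc.normc c)%:C * expi theta.
Proof.
have [->|c0] := eqVneq c 0; first by exists 0; rewrite Normc.normc0 mul0r.
have : Normc.normc c != 0 by apply: contra c0 => /eqP/Normc.eq0_normc ->.
case: c {c0} => a b /=; set r := Num.sqrt _ => r0.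
have r2 : r ^+ 2 = a ^+ 2 + b ^+ 2 by rewrite sqr_sqrtr// addr_ge0 ?sqr_ge0.
have rp : 0 < r by rewrite lt_neqAle eq_sym r0 sqrtr_ge0.
have ar : -1 <= a / r <= 1.
  rewrite -ler_norml -ler_sqr ?nnegrE// real_normK ?num_real// expr1n.
  by rewrite expr_div_n ler_pdivrMr ?exprn_gt0// mul1r r2 lerDl sqr_ge0.
have sinE : r * sin (acos (a / r)) = `|b|.
  rewrite sin_acos//; have -> : 1 - (a / r) ^+ 2 = (b / r) ^+ 2.
    rewrite !expr_div_n -[1](divff (x := r ^+ 2)) ?sqrf_eq0// -mulrBl r2.
    by rewrite addrAC subrr add0r.
  by rewrite sqrtr_sqr normrM normfV (gtr0_norm rp) mulrC divfK.
have cosE : r * cos (acos (a / r)) = a by rewrite acosK ?itvE// mulrC divfK.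
(* [acos] takes its values in [0, pi], where the sine is nonnegative; for
   b < 0 the angle is the opposite one. *)
have [b0|b0] := leP 0 b.
  exists (acos (a / r)); rewrite /expi; simpc; rewrite cosE sinE ger0_norm//.
exists (- acos (a / r)); rewrite /expi cosN sinN; simpc.
by rewrite cosE sinE ltr0_norm ?opprK.
Qed.

Lemma normc_expi (R : realType) (t : R) : Normc.normc (expi t) = 1.
Proof. by rewrite /= cos2Dsin2 sqrtr1. Qed.

End Phases.

(** * The norm [wnu N nu] *)

Section Wnu.
Local Open Scope complex_scope.
Context {R : realType} {H : hilbertType R} (N : bop H -> R) (nu : R).
Hypotheses (normN : is_norm N) (nu01 : 0 <= nu <= 1).
Implicit Types A B : bop H.

Lemma normc_real (r : R) : Normc.normc r%:C = `|r|.
Proof. by rewrite /= expr0n addr0 sqrtr_sqr. Qed.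

Lemma is_normN A : N (- A) = N A.
Proof.
by rewrite -scaleN1r (is_normZ normN) normcN Normc.normc1 mul1r.
Qed.

Lemma N_Rnu_le_max t A :
  N (Rnu nu (expi t *: A)) <= Num.max (N A) (N (adjoint A)).
Proof.
have [nu0 nu1] := andP nu01; have nu1' : 0 <= 1 - nu by lra.
rewrite /Rnu adjointZ; apply: le_trans (is_normD normN _ _) _.
rewrite !(is_normZ normN) !normc_real !ger0_norm// normc_expi.
have -> : Normc.normc (expi t)^* = 1 by rewrite /= sqrrN cos2Dsin2 sqrtr1.
rewrite !mul1r.
have : N A <= Num.max (N A) (N (adjoint A)) by rewrite le_max lexx.
have : N (adjoint A) <= Num.max (N A) (N (adjoint A)).
  by rewrite le_max lexx orbT.
by nra.
Qed.

Lemma wnu_le_max A : (wnu N nu A <= (Num.max (N A) (N (adjoint A)))%:E)%E.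
Proof. by apply: ge_ereal_sup => _ [t _ <-]; rewrite lee_fin N_Rnu_le_max. Qed.

Lemma wnu_fin_num A : wnu N nu A \is a fin_num.
Proof.
rewrite ge0_fin_numE; first exact: le_lt_trans (wnu_le_max A) (ltry _).
apply: le_trans (ereal_sup_ubound _); last by exists 0.
by rewrite lee_fin (is_norm_ge0 normN).
Qed.

Local Notation w A := (fine (wnu N nu A)).

Lemma wnu_le (M : R) A : (forall t, N (Rnu nu (expi t *: A)) <= M) -> w A <= M.
Proof.
move=> NM; rewrite -lee_fin fineK ?wnu_fin_num//.
by apply: ge_ereal_sup => _ [t _ <-]; rewrite lee_fin.
Qed.

Lemma N_Rnu_expi_le t A : N (Rnu nu (expi t *: A)) <= w A.
Proof.
by rewrite -lee_fin fineK ?wnu_fin_num//; apply: ereal_sup_ubound; exists t.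
Qed.

(** The single place where phases are absorbed by the supremum: the cases
    c = 1 and c = i give the lower bounds, arbitrary c gives homogeneity. *)
Lemma N_RnuZ_le (c : R[i]) A : N (Rnu nu (c *: A)) <= Normc.normc c * w A.
Proof.
have [t {1}->] := polar _ c.
have n0 : 0 <= Normc.normc c by case: (c) => *; rewrite sqrtr_ge0.
rewrite -scalerA RnuZ (is_normZ normN) normc_real ger0_norm//.
by rewrite ler_wpM2l ?N_Rnu_expi_le.
Qed.

Lemma N_Rnu_le A : N (Rnu nu A) <= w A.
Proof. by have := N_RnuZ_le 1 A; rewrite scale1r Normc.normc1 mul1r. Qed.

Lemma wnu_ge0 A : 0 <= w A.
Proof. exact: le_trans (is_norm_ge0 normN _) (N_Rnu_le A). Qed.

Lemma N_skew_le A : N (nu%:C *: A - (1 - nu)%:C *: adjoint A) <= w A.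
Proof.
have i1 : Normc.normc ('i : R[i]) = 1 by rewrite /= expr0n expr1n add0r sqrtr1.
by have := N_RnuZ_le 'i A; rewrite Rnu_i (is_normZ normN) i1 !mul1r.
Qed.

Lemma nuN_le A : nu * N A <= w A.
Proof.
have [nu0 nu1] := andP nu01.
have -> : nu * N A = N (nu%:C *: A).
  by rewrite (is_normZ normN) normc_real ger0_norm.
set X := nu%:C *: A; set Y := (1 - nu)%:C *: adjoint A.
have E : 2%:C *: X = (X + Y) + (X - Y).
  by rewrite addrACA subrr addr0 -mulr2n rmorph_nat scaler_nat.
have := is_normD normN (X + Y) (X - Y).
rewrite -E (is_normZ normN) normc_real ger0_norm//.
have := N_Rnu_le A; have := N_skew_le A; rewrite /Rnu -/X -/Y; lra.
Qed.

Lemma nuNadjoint_le A : (1 - nu) * N (adjoint A) <= w A.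
Proof.
have [nu0 nu1] := andP nu01.
have -> : (1 - nu) * N (adjoint A) = N ((1 - nu)%:C *: adjoint A).
  by rewrite (is_normZ normN) normc_real ger0_norm// subr_ge0.
set X := nu%:C *: A; set Y := (1 - nu)%:C *: adjoint A.
have E : 2%:C *: Y = (X + Y) - (X - Y).
  by rewrite opprB addrC addrA subrK -mulr2n rmorph_nat scaler_nat.
have := is_normD normN (X + Y) (- (X - Y)).
rewrite -E is_normN (is_normZ normN) normc_real ger0_norm//.
have := N_Rnu_le A; have := N_skew_le A; rewrite /Rnu -/X -/Y; lra.
Qed.

Lemma wnu_scale_le (c : R[i]) A : w (c *: A) <= Normc.normc c * w A.
Proof.
apply: wnu_le => t; rewrite scalerA.
by apply: le_trans (N_RnuZ_le _ _) _; rewrite Normc.normcM normc_expi mul1r.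
Qed.

Lemma wnuZ (c : R[i]) A : w (c *: A) = Normc.normc c * w A.
Proof.
apply/eqP; rewrite eq_le wnu_scale_le /=.
have [->|c0] := eqVneq c 0; first by rewrite Normc.normc0 mul0r wnu_ge0.
have n0 : 0 < Normc.normc c.
  rewrite lt_neqAle eq_sym; apply/andP; split; last first.
    by case: (c) => *; rewrite sqrtr_ge0.
  by apply: contra c0 => /eqP/Normc.eq0_normc ->.
rewrite mulrC -ler_pdivlMr// mulrC -Normc.normcV.
by have := wnu_scale_le c^-1 (c *: A); rewrite scalerA mulVf// scale1r.
Qed.

Lemma wnuD A B : w (A + B) <= w A + w B.
Proof.
apply: wnu_le => t; rewrite scalerDr RnuD.
by apply: le_trans (is_normD normN _ _) _; rewrite lerD ?N_Rnu_expi_le.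
Qed.

(** If nu > 0 then [nu N A <= 0] kills A; if nu = 0 then [N A' <= 0] kills
    A', hence A = A''. *)
Lemma wnu_eq0 A : w A = 0 -> A = 0.
Proof.
move=> wA; have := nuN_le A; have := nuNadjoint_le A; rewrite wA => NA' NA.
have NA0 := is_norm_ge0 normN A; have NA'0 := is_norm_ge0 normN (adjoint A).
have [nu0|nu_gt0] := leP nu 0; last by apply: (is_norm_eq0 normN); nra.
have A0 : adjoint A = 0 by apply: (is_norm_eq0 normN); nra.
by rewrite -(adjointK A) A0 adjoint0.
Qed.

End Wnu.

Theorem theorem2p6 (R : realType) (H : hilbertType R) (N : bop H -> R) (nu : R)
    (normN : is_norm N) (nu01 : 0 <= nu <= 1) :
  [/\ forall A : bop H, wnu N nu A \is a fin_num,
      is_norm (fun A : bop H => fine (wnu N nu A)) &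
      forall A : bop H,
        ((Num.max (nu * N A) ((1 - nu) * N (adjoint A)))%:E <= wnu N nu A)%E /\
        (wnu N nu A <= (Num.max (N A) (N (adjoint A)))%:E)%E].
Proof.
split; first exact: wnu_fin_num.
- split; [exact: wnu_ge0 | exact: wnu_eq0 | exact: wnuZ | exact: wnuD].
- move=> A; split; last exact: wnu_le_max.
  by rewrite -[leRHS]fineK ?wnu_fin_num// lee_fin ge_max nuN_le ?nuNadjoint_le.
Qed.
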